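(* Let $\mathfrak q=\mathrm{Lie}(Q)$ be the Lie algebra of a complex algebraic group $Q$, and suppose that $\mathfrak q$ is Frobenius. Then any Ooms element $x_\xi\in\mathfrak q$ is semisimple.
   Context: For a Lie algebra $\mathfrak q$ and $\eta\in\mathfrak q^*$, the Kirillov form is $\mathcal B_\eta(x,y)=\langle\eta,[x,y]\rangle=-\langle\mathrm{ad}^*(x)\eta,y\rangle$ for $x,y\in\mathfrak q$; its kernel is the stabiliser $\mathfrak q^\eta$. The Lie algebra $\mathfrak q$ is Frobenius if there is $\xi\in\mathfrak q^*$ such that $\mathcal B_\xi$ is non-degenerate, i.e., $\mathfrak q^\xi=\{0\}$; such $\xi$ are exactly the regular elements of $\mathfrak q^*$ (set $\mathfrak q^*_{\rm reg}$). For a Frobenius $\mathfrak q$ and $\xi\in\mathfrak q^*_{\rm reg}$, the Ooms element $x_\xi\in\mathfrak q$ associated with $\xi$ is the element corresponding to $\xi$ under the isomorphism $\mathfrak q\simeq\mathfrak q^*$ given by $\mathcal B_\xi$; equivalently, $x_\xi$ is the unique element of $\mathfrak q$ with $(\mathrm{ad}^*x_\xi)\cdot\xi=-\xi$. Semisimplicity is in the sense of the Jordan decomposition in the Lie algebra of an algebraic group. *)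

(* Defs.v *)
From HB Require Import structures.
From mathcomp Require Import all_boot all_order all_algebra.
From mathcomp Require Import mpoly complex boolp reals ring.

Set Implicit Arguments.
Unset Strict Implicit.
Unset Printing Implicit Defensive.

Import Order.TTheory GRing.Theory Num.Theory.
Local Open Scope ring_scope.

HB.mixin Record Vector_isLieAlgebra (K : fieldType) L of Vector K L := {
  lie_bracket : L -> L -> L;
  lie_bracket_linearl : forall y, linear (lie_bracket^~ y);
  lie_bracket_linearr : forall x, linear (lie_bracket x);
  lie_bracketxx : forall x, lie_bracket x x = 0;
  lie_jacobi : forall x y z,
    lie_bracket x (lie_bracket y z) + lie_bracket y (lie_bracket z x)
      + lie_bracket z (lie_bracket x y) = 0
}.

#[short(type="lieAlgType")]
HB.structure Definition LieAlgebra (K : fieldType) :=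
  { L of Vector_isLieAlgebra K L & Vector K L }.

Section Frobenius.
Variables (K : fieldType) (L : lieAlgType K).

Definition dual : Type := 'Hom(L, K^o).

Implicit Types (xi eta : dual) (x y : L).

Definition kirillov eta x y : K := eta (lie_bracket x y).

Definition nondegenerate (B : L -> L -> K) : Prop :=
  forall x, (forall y, B x y = 0) -> x = 0.

Definition frobenius : Prop := exists xi, nondegenerate (kirillov xi).

(* [linfun f] is only meaningful when f is linear: see [coadE] and
   [mem_stabiliser]. *)
Definition coad x eta : dual := linfun (fun y => - kirillov eta x y : K^o).

Definition stabiliser eta : {vspace L} := lker (linfun (coad^~ eta)).

Definition regular eta : Prop :=
  forall eta', (\dim (stabiliser eta) <= \dim (stabiliser eta'))%N.

(* x is the preimage of xi under the map x |-> kirillov xi x from L to its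
   dual; see [ooms_elementP] for the form (ad^* x) xi = - xi. *)
Definition ooms_element xi x : Prop := forall y, kirillov xi x y = xi y.

Lemma coadE x eta y : coad x eta y = - kirillov eta x y.
Proof.
pose f := fun y => - kirillov eta x y : K^o.
have f_lin : linear f.
  move=> a u v; rewrite /f /kirillov lie_bracket_linearr linearP.
  by rewrite opprD scalerN.
pose F : {linear L -> K^o} :=
  HB.pack f (GRing.isLinear.Build K L K^o _ f f_lin).
exact: (lfunE F).
Qed.

Lemma mem_stabiliser eta x :
  x \in stabiliser eta <-> forall y, kirillov eta x y = 0.
Proof.
pose f := coad^~ eta.
have f_lin : linear f.
  move=> a u v; apply/lfunP => y.
  rewrite add_lfunE scale_lfunE !coadE /kirillov lie_bracket_linearl linearP.
  by rewrite opprD scalerN.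
pose F : {linear L -> dual} :=
  HB.pack f (GRing.isLinear.Build K L dual _ f f_lin).
rewrite memv_ker -[linfun _]/(linfun F) lfunE /=; split=> [/eqP fx0 y|Bx0].
  by apply/eqP; rewrite -oppr_eq0 -coadE -/(f x) fx0 zero_lfunE.
by apply/eqP/lfunP => y; rewrite coadE Bx0 zero_lfunE oppr0.
Qed.

Lemma ooms_elementP xi x : ooms_element xi x <-> coad x xi = - xi.
Proof.
split=> [oomsx | /lfunP eqx y].
  by apply/lfunP => y; rewrite coadE oomsx opp_lfunE.
by apply/oppr_inj; rewrite -coadE eqx opp_lfunE.
Qed.

Lemma nondegenerateP eta :
  nondegenerate (kirillov eta) <-> stabiliser eta = 0%VS.
Proof.
split=> [nd | st0 x /mem_stabiliser]; last by rewrite st0 memv0 => /eqP.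
apply/eqP; rewrite -subv0; apply/subvP => x /mem_stabiliser /nd ->.
exact: mem0v.
Qed.

Lemma frobenius_regularP eta :
  frobenius -> regular eta <-> nondegenerate (kirillov eta).
Proof.
move=> [xi /nondegenerateP xi0]; split=> [/(_ xi) | /nondegenerateP eta0 eta'].
  by rewrite xi0 dimv0 leqn0 dimv_eq0 => /eqP /nondegenerateP.
by rewrite eta0 dimv0.
Qed.

End Frobenius.

Section AlgebraicGroups.
Variables (C : closedFieldType) (n : nat).

Definition mx_eval (p : {mpoly C[n * n]}) (g : 'M[C]_n) : C := p.@[mxvec g 0].

(* The derivative of p at the matrix g in the direction X. *)
Definition mx_diff (p : {mpoly C[n * n]}) (g X : 'M[C]_n) : C :=
  \sum_(k < n * n) (p^`M(k)).@[mxvec g 0] * mxvec X 0 k.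

(* Linear algebraic groups, as Zariski-closed subgroups of GL_n. The closed
   subsets of GL_n are cut out by polynomials in the matrix entries alone, since
   denominators det^k can be cleared. *)
Record algGroup : Type := AlgGroup {
  alg_group :> 'M[C]_n -> Prop;
  alg_group_closed : exists S : {mpoly C[n * n]} -> Prop, forall g,
    alg_group g <-> g \in unitmx /\ forall p, S p -> mx_eval p g = 0;
  alg_group1 : alg_group 1%:M;
  alg_groupM : forall g h, alg_group g -> alg_group h -> alg_group (g *m h);
  alg_groupV : forall g, alg_group g -> alg_group (invmx g)
}.

Variable Q : algGroup.

Definition vanishing_ideal (p : {mpoly C[n * n]}) : Prop :=
  forall g, Q g -> mx_eval p g = 0.

(* The tangent space of Q at the identity (for the reduced structure). *)
Definition tangent1 (X : 'M[C]_n) : Prop :=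
  forall p, vanishing_ideal p -> mx_diff p 1%:M X = 0.

End AlgebraicGroups.

Section LieOfAlgebraicGroup.
Variables (C : closedFieldType) (n : nat) (Q : algGroup C n).
Implicit Types (p q : {mpoly C[n * n]}) (g X Y : 'M[C]_n).

Lemma vspace_of_linear_pred (K : fieldType) (V : vectType K) (P : V -> Prop) :
    P 0 -> (forall a u v, P u -> P v -> P (a *: u + v)) ->
  exists U : {vspace V}, forall v, v \in U <-> P v.
Proof.
move=> P0 PL.
pose inP (U : {vspace V}) := forall v, v \in U -> P v.
suff step : forall d (U : {vspace V}), (\dim {:V} - \dim U <= d)%N -> inP U ->
    exists U' : {vspace V}, forall v, v \in U' <-> P v.
  apply: (step _ 0%VS (leqnn _)) => v; rewrite memv0 => /eqP -> //.
elim=> [|d IHd] U ledU PU.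
  exists U => v; split=> [/PU // | _].
  suff -> : U = fullv by rewrite memvf.
  apply/eqP; rewrite -(dimv_leqif_eq (subvf U)) eqn_leq dimvS ?subvf //=.
  by rewrite -subn_eq0 -leqn0.
have [[v [Pv vU]] | noU] := pselect (exists v, P v /\ v \notin U); last first.
  exists U => v; split=> [/PU // | Pv].
  by apply: contrapT => /negP vU; apply: noU; exists v.
apply: (IHd (U + <[v]>)%VS).
  have ltU : (\dim U < \dim (U + <[v]>))%N.
    rewrite ltn_neqAle dimvS ?addvSl // andbT.
    rewrite (dimv_leqif_eq (addvSl U <[v]>)).
    apply: contra vU => /eqP ->.
    by rewrite (subvP (addvSr U <[v]>)) ?memv_line.
  have leU : (\dim (U + <[v]>) <= \dim {:V})%N by rewrite dimvS ?subvf.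
  rewrite leq_subLR in ledU; rewrite leq_subLR (leq_trans ledU) //.
  by rewrite addnS -addSn leq_add2r.
move=> w /memv_addP [u uU [_ /vlineP [a ->] ->]].
by rewrite addrC; apply: PL => //; apply: PU.
Qed.

Lemma mx_diff_linear p g : linear (mx_diff p g : 'M[C]_n -> C^o).
Proof.
move=> a X Y; rewrite /mx_diff scaler_sumr -big_split /=.
apply: eq_bigr => k _; rewrite linearP !mxE mulrDr; congr (_ + _).
by rewrite mulrCA.
Qed.

Lemma tangent1_vspace :
  exists U : {vspace 'M[C]_n}, forall X, X \in U <-> tangent1 Q X.
Proof.
apply: vspace_of_linear_pred => [p _ | a X Y tX tY p Ip].
  by rewrite /mx_diff big1 // => k _; rewrite linear0 mxE mulr0.
by rewrite mx_diff_linear tX // tY // scaler0 addr0.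
Qed.

Definition Lie_vspace : {vspace 'M[C]_n} := projT1 (cid tangent1_vspace).

Lemma mem_Lie_vspace X : X \in Lie_vspace <-> tangent1 Q X.
Proof. exact: (projT2 (cid tangent1_vspace)). Qed.

Let ent g (k : 'I_(n * n)) : C := mxvec g 0 k.

(* The polynomial h |-> p (g *m h) *)
Let gvar g : 'I_(n * n) -> {mpoly C[n * n]} :=
  fun k => \sum_l (ent (g *m vec_mx (delta_mx 0 l)) k) *: 'X_l.

Lemma ent_mulmx g h k :
  ent (g *m h) k = \sum_l ent h l * ent (g *m vec_mx (delta_mx 0 l)) k.
Proof.
rewrite /ent -{1}[h]mxvecK {1}(row_sum_delta (mxvec h)).
rewrite linear_sum mulmx_sumr linear_sum summxE; apply: eq_bigr => l _.
by rewrite linearZ -scalemxAr linearZ mxE.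
Qed.

Lemma gvarE g h k : (gvar g k).@[ent h] = ent (g *m h) k.
Proof.
rewrite ent_mulmx raddf_sum; apply: eq_bigr => l _.
by rewrite /= mevalZ mevalXU mulrC.
Qed.

Let tr g p := p \mPo [tuple gvar g k | k < n * n].

Lemma mx_eval_tr g p h : mx_eval (tr g p) h = mx_eval p (g *m h).
Proof.
rewrite /mx_eval comp_mpoly_meval; apply: meval_eq => k.
by rewrite tnth_mktuple gvarE.
Qed.

(* Leibniz rule *)
Lemma mx_diffM p q g X : mx_diff (p * q) g X =
  mx_diff p g X * mx_eval q g + mx_eval p g * mx_diff q g X.
Proof.
rewrite /mx_diff mulr_suml mulr_sumr -big_split /=; apply: eq_bigr => k _.
by rewrite mderivM mevalD !mevalM mulrDl -!mulrA [X in _ * X + _]mulrC.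
Qed.

Lemma mx_diffD p q g X :
  mx_diff (p + q) g X = mx_diff p g X + mx_diff q g X.
Proof.
rewrite /mx_diff -big_split /=; apply: eq_bigr => k _.
by rewrite mderivD mevalD mulrDl.
Qed.

Lemma mx_diffZ c p g X : mx_diff (c *: p) g X = c * mx_diff p g X.
Proof.
rewrite /mx_diff mulr_sumr; apply: eq_bigr => k _.
by rewrite mderivZ mevalZ mulrA.
Qed.

Lemma mx_diffC c g X : mx_diff c%:MP g X = 0.
Proof. by rewrite /mx_diff big1 // => k _; rewrite mderivC meval0 mul0r. Qed.

Lemma mx_diff_sum (I : finType) (F : I -> {mpoly C[n * n]}) g X :
  mx_diff (\sum_i F i) g X = \sum_i mx_diff (F i) g X.
Proof.
apply: (big_morph (fun p => mx_diff p g X)) => [p q|]; first exact: mx_diffD.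
exact: (mx_diffC 0).
Qed.

Lemma mx_diffXU l g X : mx_diff 'X_l g X = ent X l.
Proof.
rewrite /mx_diff (bigD1 l) //= big1 ?addr0 => [|k kl]; rewrite mderivX mnm1E.
  by rewrite eqxx scale1r (_ : (_ - _)%MM = 0%MM) ?mpolyX0 ?meval1 ?mul1r //; apply/mnmP => i; rewrite mnmBE subnn mnm0E.
by rewrite eq_sym (negPf kl) scale0r meval0 mul0r.
Qed.

(* Chain rule *)
Lemma mx_diff_tr g p X : mx_diff (tr g p) 1%:M X = mx_diff p g (g *m X).
Proof.
have var k : mx_diff (tr g 'X_k) 1%:M X = mx_diff 'X_k g (g *m X).
  rewrite mx_diffXU /tr comp_mpolyXU -tnth_nth tnth_mktuple mx_diff_sum.
  rewrite ent_mulmx; apply: eq_bigr => l _.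
  by rewrite mx_diffZ mx_diffXU mulrC.
have trM q1 q2 : tr g (q1 * q2) = tr g q1 * tr g q2 by exact: rmorphM.
have stepM q1 q2 : mx_diff (tr g q1) 1%:M X = mx_diff q1 g (g *m X) ->
    mx_diff (tr g q2) 1%:M X = mx_diff q2 g (g *m X) ->
    mx_diff (tr g (q1 * q2)) 1%:M X = mx_diff (q1 * q2) g (g *m X).
  by move=> e1 e2; rewrite trM !mx_diffM e1 e2 !mx_eval_tr !mulmx1.
have one : mx_diff (tr g 1) 1%:M X = mx_diff 1 g (g *m X).
  by rewrite /tr comp_mpoly1 !(mx_diffC 1).
elim/mpolyind: p => [|c m p _ _ IHp].
  by rewrite /tr comp_mpoly0 !(mx_diffC 0).
rewrite /tr comp_mpolyD comp_mpolyZ !mx_diffD !mx_diffZ -/(tr g p) IHp.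
congr (c * _ + _); rewrite -/(tr g _) mpolyXE_id.
elim/big_ind: _ => [||i _]; [exact: one | exact: stepM |].
elim: (m i) => [|e IHe]; first exact: one.
by rewrite exprS; apply: stepM.
Qed.

(* The left-invariant vector field of Y applied to p *)
Let inv_field Y p : {mpoly C[n * n]} :=
  \sum_k p^`M(k) * (\sum_l ent (vec_mx (delta_mx 0 l) *m Y) k *: 'X_l).

Lemma ent_mulmxr g Y k :
  ent (g *m Y) k = \sum_l ent (vec_mx (delta_mx 0 l) *m Y) k * ent g l.
Proof.
rewrite /ent -{1}[g]mxvecK {1}(row_sum_delta (mxvec g)).
rewrite linear_sum mulmx_suml linear_sum summxE; apply: eq_bigr => l _.
by rewrite linearZ -scalemxAl linearZ mxE mulrC.
Qed.

Lemma inv_fieldE Y p g : mx_eval (inv_field Y p) g = mx_diff p g (g *m Y).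
Proof.
rewrite /mx_eval /mx_diff raddf_sum; apply: eq_bigr => k _.
rewrite /= mevalM -[mxvec (g *m Y) 0 k]/(ent _ k) ent_mulmxr.
congr (_ * _); rewrite raddf_sum; apply: eq_bigr => l _.
by rewrite /= mevalZ mevalXU.
Qed.

Lemma inv_field_ideal Y p :
  tangent1 Q Y -> vanishing_ideal Q p -> vanishing_ideal Q (inv_field Y p).
Proof.
move=> tY Ip g Qg; rewrite inv_fieldE -mx_diff_tr; apply: tY => h Qh.
by rewrite mx_eval_tr; apply: Ip; apply: alg_groupM.
Qed.

Lemma mx_diff_inv_field X Y p : mx_diff (inv_field Y p) 1%:M X =
  (\sum_k \sum_l (p^`M(k)^`M(l)).@[ent 1%:M] * ent X l * ent Y k)
    + mx_diff p 1%:M (X *m Y).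
Proof.
rewrite mx_diff_sum {2}/mx_diff -big_split /=; apply: eq_bigr => k _.
rewrite mx_diffM mx_diff_sum; congr (_ + _); last first.
  congr (_ * _); rewrite -[RHS]/(ent _ k) ent_mulmxr; apply: eq_bigr => l _.
  by rewrite mx_diffZ mx_diffXU.
rewrite -mulr_suml; congr (_ * _).
rewrite -[in RHS](mul1mx Y) ent_mulmxr /mx_eval raddf_sum.
by apply: eq_bigr => l _; rewrite /= mevalZ mevalXU.
Qed.

Lemma Lie_vspace_bracket X Y :
  X \in Lie_vspace -> Y \in Lie_vspace -> X *m Y - Y *m X \in Lie_vspace.
Proof.
move=> /mem_Lie_vspace tX /mem_Lie_vspace tY; apply/mem_Lie_vspace => p Ip.
have eXY := tX _ (inv_field_ideal tY Ip).
have eYX := tY _ (inv_field_ideal tX Ip).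
rewrite mx_diff_inv_field in eXY; rewrite mx_diff_inv_field in eYX.
pose S A B := \sum_k \sum_l (p^`M(k)^`M(l)).@[ent 1%:M] * ent A l * ent B k.
have S_sym : S X Y = S Y X.
  rewrite /S exchange_big /=; apply: eq_bigr => k _; apply: eq_bigr => l _.
  by rewrite mderiv_comm -!mulrA [ent X _ * _]mulrC.
rewrite -[X *m Y - _]addrC -scaleN1r mx_diff_linear scaleN1r addrC.
by apply/eqP; rewrite subr_eq0 -(inj_eq (addrI (S X Y))) {2}S_sym eXY eYX.
Qed.

Definition Lie : Type := subvs_of Lie_vspace.

HB.instance Definition _ := Vector.on Lie.

Implicit Types x y z s u : Lie.

(* By [Lie_vspace_bracket], the projection [vsproj] acts trivially here. *)
Definition Lie_bracket x y : Lie :=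
  vsproj Lie_vspace (vsval x *m vsval y - vsval y *m vsval x).

Lemma Lie_bracketE x y :
  vsval (Lie_bracket x y) = vsval x *m vsval y - vsval y *m vsval x.
Proof. by rewrite vsprojK // Lie_vspace_bracket ?subvsP. Qed.

Lemma Lie_vsvalP a x y : vsval (a *: x + y) = a *: vsval x + vsval y.
Proof. exact: linearP. Qed.

Lemma Lie_vsvalD x y : vsval (x + y) = vsval x + vsval y.
Proof. exact: linearD. Qed.

Lemma Lie_bracket_linearl y : linear (Lie_bracket^~ y).
Proof.
move=> a u v; apply: val_inj; rewrite -[RHS]/(vsval _) -[LHS]/(vsval _) Lie_vsvalP !Lie_bracketE Lie_vsvalP.
rewrite mulmxDl mulmxDr -scalemxAl -scalemxAr scalerBr opprD.
by rewrite addrACA.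
Qed.

Lemma Lie_bracket_linearr x : linear (Lie_bracket x).
Proof.
move=> a u v; apply: val_inj; rewrite -[RHS]/(vsval _) -[LHS]/(vsval _) Lie_vsvalP !Lie_bracketE Lie_vsvalP.
rewrite mulmxDl mulmxDr -scalemxAl -scalemxAr scalerBr opprD.
by rewrite addrACA.
Qed.

Lemma Lie_bracketxx x : Lie_bracket x x = 0.
Proof. by apply: val_inj; rewrite -[LHS]/(vsval _) Lie_bracketE subrr. Qed.

Lemma Lie_jacobi x y z :
  Lie_bracket x (Lie_bracket y z) + Lie_bracket y (Lie_bracket z x)
    + Lie_bracket z (Lie_bracket x y) = 0.
Proof.
apply: val_inj; rewrite -[LHS]/(vsval _) -[RHS]/(0 : 'M[C]_n).
rewrite !Lie_vsvalD !Lie_bracketE.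
move: (vsval x) (vsval y) (vsval z) => A B D.
rewrite !mulmxBl !mulmxBr !mulmxA.
move: (A *m B *m D) (A *m D *m B) (B *m A *m D) => a1 a2 a3.
move: (B *m D *m A) (D *m A *m B) (D *m B *m A) => a4 a5 a6.
by apply/matrixP => i j; rewrite !mxE; ring.
Qed.

HB.instance Definition _ := Vector_isLieAlgebra.Build C Lie
  Lie_bracket_linearl Lie_bracket_linearr Lie_bracketxx Lie_jacobi.

(* The additive Jordan decomposition in Lie Q: it is computed in matrices, and
   does not depend on the embedding of Q in a general linear group. *)
Definition jordan_decomposition x s u : Prop :=
  [/\ x = s + u, diagonalizable (vsval s),
      exists k, vsval u ^+ k = 0 & lie_bracket s u = 0].

(* x is its own semisimple part *)
Definition semisimple x : Prop := jordan_decomposition x x 0.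

End LieOfAlgebraicGroup.

(* Main.v *)
Require Import Defs.
From HB Require Import structures.
From mathcomp Require Import all_boot all_order all_algebra.
From mathcomp Require Import mpoly complex boolp reals ring.

Set Implicit Arguments.
Unset Strict Implicit.
Unset Printing Implicit Defensive.

Import Order.TTheory GRing.Theory Num.Theory.
Local Open Scope ring_scope.

(** Write the matrix of x as S + N, with S diagonalizable, N nilpotent and
    S N = N S.  Two facts give the theorem.

    First, S lies in Lie Q ([Lie_semisimple_part]).  A matrix Y acts on the
    polynomials in the matrix entries as the derivation p |-> (g |-> dp_g(g Y)),
    and the derivation attached to an element of Lie Q preserves the vanishing
    ideal of Q.  The derivations attached to S and N commute, and every
    polynomial is a finite sum of eigenvectors of the first that are killed by
    powers of the second: this holds for linear forms and passes to products by
    the Leibniz rule.  Hence, on any given polynomial, the derivation of S is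
    a polynomial in the derivation of S + N, so it preserves the ideal too.
    Evaluating at the identity shows that S is tangent to Q.

    Second, xi [s, y] = xi y for all y, where s is S seen in Lie Q
    ([ooms_semisimple]).  The Ooms equation says that xi o ad x = xi, hence
    xi o p(ad x) = p(1) xi for every polynomial p.  Again [s, y] = p(ad x) y for
    some p, which may be chosen with p(1) = 1.

    So xi [x - s, y] = 0 for all y, and x = s because the Kirillov form is
    nondegenerate.

    Both facts use [semisimple_part_polact]: if v is a sum of eigenvectors of S
    killed by powers of N, then S v = p(S + N) v for an interpolation polynomial
    p that takes the value a to high order at each eigenvalue a involved.
    Working one vector at a time avoids any finiteness assumption on the ambient
    space, so that it applies to the algebra of all polynomials. *)

(** * Polynomials in an endomorphism *)

Section PolynomialAction.
Variables (K : fieldType) (V : lmodType K).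
Implicit Types (S N : {linear V -> V}) (p q : {poly K}) (v w : V).

Lemma iter_linear (f : {linear V -> V}) i : linear (iter i f).
Proof. by move=> a v w; elim: i => //= i ->; rewrite linearP. Qed.

HB.instance Definition _ (f : {linear V -> V}) i :=
  GRing.isLinear.Build K V V _ (iter i f) (iter_linear f i).

(** This is p(f) v; no algebra of endomorphisms of V is formed, since V may have
    infinite dimension. *)
Definition polact (f : V -> V) p v : V := \sum_(i < size p) p`_i *: iter i f v.

Lemma polact_wide f m p v :
  (size p <= m)%N -> polact f p v = \sum_(i < m) p`_i *: iter i f v.
Proof.
move=> le_p_m; rewrite /polact.
rewrite (big_ord_widen _ (fun i => p`_i *: iter i f v) le_p_m).
rewrite big_mkcond; apply: eq_bigr => i _; case: ltnP => // le_p_i.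
by rewrite nth_default // scale0r.
Qed.

Lemma polactDl f p q v : polact f (p + q) v = polact f p v + polact f q v.
Proof.
rewrite (polact_wide _ _ (size_polyD p q)).
rewrite (polact_wide _ v (leq_maxl (size p) (size q))).
rewrite (polact_wide _ v (leq_maxr (size p) (size q))) -big_split /=.
by apply: eq_bigr => i _; rewrite coefD scalerDl.
Qed.

Lemma polactC f c v : polact f c%:P v = c *: v.
Proof. by rewrite (polact_wide _ _ (size_polyC_leq1 c)) big_ord1 coefC. Qed.

Lemma polactCM f c p v : polact f (c%:P * p) v = c *: polact f p v.
Proof.
have le_cp : (size (c%:P * p)%R <= size p)%N.
  by rewrite mul_polyC; apply: size_scale_leq.
rewrite (polact_wide _ _ le_cp) /polact scaler_sumr.
by apply: eq_bigr => i _; rewrite coefCM scalerA.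
Qed.

Lemma polactMX f p v : polact f (p * 'X) v = polact f p (f v).
Proof.
have le_pX : (size (p * 'X)%R <= (size p).+1)%N.
  by apply: leq_trans (size_polyMleq _ _) _; rewrite size_polyX addn2.
rewrite (polact_wide _ _ le_pX) big_ord_recl coefMX scale0r add0r.
by apply: eq_bigr => i _; rewrite coefMX -iterSr.
Qed.

Lemma polact_linear (f : {linear V -> V}) p : linear (polact f p).
Proof.
move=> a v w; rewrite /polact scaler_sumr -big_split /=; apply: eq_bigr => i _.
by rewrite iter_linear scalerDr !scalerA mulrC.
Qed.

HB.instance Definition _ (f : {linear V -> V}) p :=
  GRing.isLinear.Build K V V _ (polact f p) (polact_linear f p).

Lemma polactM (f : {linear V -> V}) p q v :
  polact f (p * q) v = polact f p (polact f q v).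
Proof.
elim/poly_ind: p q v => [|p c IHp] q v.
  by rewrite mul0r !(polactC f 0) !scale0r.
rewrite mulrDl !polactDl polactCM polactC -mulrA IHp polactMX.
congr (polact f p _ + _); rewrite mulrC polactMX.
rewrite /polact linear_sum; apply: eq_bigr => i _.
by rewrite linearZ_LR -iterSr.
Qed.

Lemma polact_eigenvector (f : {linear V -> V}) p a v :
  f v = a *: v -> polact f p v = p.[a] *: v.
Proof.
move=> fv; rewrite /polact horner_coef scaler_suml; apply: eq_bigr => i _.
rewrite -scalerA; congr (_ *: _); elim: (i : nat) => [|j /= ->].
  by rewrite scale1r.
by rewrite linearZ_LR fv scalerA -exprSr.
Qed.

Lemma polact_stable f (W : V -> Prop) p v :
    W 0 -> (forall a u w, W u -> W w -> W (a *: u + w)) ->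
    (forall w, W w -> W (f w)) -> W v ->
  W (polact f p v).
Proof.
move=> W0 Wlin Wf Wv; rewrite /polact.
elim/big_ind: _ => // [u w Wu Ww|i _].
  by rewrite -[u]scale1r; apply: Wlin.
rewrite -[_ *: _]addr0; apply: Wlin => //.
by elim: (i : nat) => //= j; apply: Wf.
Qed.

End PolynomialAction.

Lemma polact_equivariant (K : fieldType) (V W : lmodType K) (f : V -> V)
    (g : W -> W) (h : {linear V -> W}) (p : {poly K}) v :
  (forall w, h (f w) = g (h w)) -> h (polact f p v) = polact g p (h v).
Proof.
move=> hf; rewrite /polact linear_sum; apply: eq_bigr => i _.
by rewrite linearZ; congr (_ *: _); elim: (i : nat) => //= j <-.
Qed.

(** * Sums of eigenvectors killed by powers of a nilpotent part *)

(** The eigenvalue and the nilpotency order may vary from term to term, so this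
    is a local form of: S is diagonalizable and N is nilpotent. *)
Inductive jordan_sum (K : fieldType) (V : lmodType K) (S N : V -> V) :
  V -> Prop :=
| jordan_sum0 : jordan_sum S N 0
| jordan_sumD a k w v of S w = a *: w & iter k N w = 0 & jordan_sum S N v :
    jordan_sum S N (w + v).

Section JordanSums.
Variables (K : fieldType) (V : lmodType K) (S N : {linear V -> V}).
Implicit Types (p : {poly K}) (v w : V).

Lemma jordan_sum_vector a k w :
  S w = a *: w -> iter k N w = 0 -> jordan_sum S N w.
Proof.
by move=> Sw Nw; rewrite -[w]addr0; apply: jordan_sumD Sw Nw (jordan_sum0 _ _).
Qed.

Lemma jordan_sum_add v w :
  jordan_sum S N v -> jordan_sum S N w -> jordan_sum S N (v + w).
Proof.
move=> + Jw; elim=> [|a k u {}v Su Nu _ IHv]; first by rewrite add0r.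
by rewrite -addrA; apply: jordan_sumD Su Nu IHv.
Qed.

Lemma jordan_sum_scale c v : jordan_sum S N v -> jordan_sum S N (c *: v).
Proof.
elim=> [|a k u {}v Su Nu _ IHv]; first by rewrite scaler0; apply: jordan_sum0.
rewrite scalerDr; apply: (@jordan_sumD _ _ _ _ a k) IHv.
  by rewrite linearZ /= Su !scalerA mulrC.
by rewrite linearZ /= Nu scaler0.
Qed.

Lemma jordan_sum_bigsum (I : finType) (F : I -> V) :
  (forall i, jordan_sum S N (F i)) -> jordan_sum S N (\sum_i F i).
Proof.
move=> JF; apply: big_ind => //; first exact: jordan_sum0.
exact: jordan_sum_add.
Qed.

Hypothesis SN : forall v, S (N v) = N (S v).

(** On the S-eigenspace for a, the operator (S + N) - a is just N. *)
Lemma polact_jordan_vector p a k w :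
    S w = a *: w -> iter k N w = 0 -> ('X - a%:P) ^+ k %| p - a%:P ->
  polact (S \+ N) p w = S w.
Proof.
move=> Sw Nkw /dvdpP[q Dp]; rewrite -[p](subrK a%:P) Dp.
rewrite polactDl polactC polactM.
suff -> : polact (S \+ N) (('X - a%:P) ^+ k) w = iter k N w.
  by rewrite Nkw linear0 add0r Sw.
elim: k w Sw {Nkw Dp} => [|k IHk] w Sw.
  by rewrite expr0 (polactC _ 1) scale1r.
have factor u : polact (S \+ N) ('X - a%:P) u = S u + N u - a *: u.
  rewrite -polyCN -['X]mul1r polactDl polactC polactMX (polactC _ 1).
  by rewrite scale1r scaleNr.
rewrite iterSr exprSr polactM factor Sw addrAC subrr add0r IHk //.
by rewrite SN Sw linearZ.
Qed.

(** The bound comes from v alone, and any p that meets it works: this leaves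
    room to prescribe one more value of p. *)
Lemma jordan_sum_semisimple_part v : jordan_sum S N v ->
  exists (s : seq K) (k : nat), forall p,
    (forall a, a \in s -> ('X - a%:P) ^+ k %| p - a%:P) ->
  polact (S \+ N) p v = S v.
Proof.
elim=> [|a k w {}v Sw Nw _ [s [l IHv]]].
  by exists [::], 0 => p _; rewrite !linear0.
exists (a :: s), (maxn k l) => p Dp.
rewrite !linearD /= IHv ?(polact_jordan_vector Sw Nw) //.
  by apply: dvdp_trans (Dp a (mem_head _ _)); rewrite dvdp_exp2l ?leq_maxl.
move=> b sb; apply: dvdp_trans (Dp b _); last by rewrite inE sb orbT.
by rewrite dvdp_exp2l ?leq_maxr.
Qed.

End JordanSums.

Lemma jordan_sum_image (K : fieldType) (V W : lmodType K) (S N : V -> V)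
    (S' N' : W -> W) (h : {linear V -> W}) v :
    (forall u, h (S u) = S' (h u)) -> (forall u, h (N u) = N' (h u)) ->
  jordan_sum S N v -> jordan_sum S' N' (h v).
Proof.
move=> hS hN; elim=> [|a k u {}v Su Nu _ IHv].
  by rewrite linear0; apply: jordan_sum0.
rewrite linearD; apply: (@jordan_sumD _ _ _ _ a k) IHv.
  by rewrite -hS Su linearZ.
have <- : h (iter k N u) = iter k N' (h u).
  by elim: k {Nu} => //= k <-.
by rewrite Nu linear0.
Qed.

(** The Chinese remainder theorem for the moduli (X - a)^k. *)
Lemma poly_interpolation (K : fieldType) (s : seq K) k :
  exists p : {poly K}, forall a, a \in s -> ('X - a%:P) ^+ k %| p - a%:P.
Proof.
elim: s => [|a s [p Dp]]; first by exists 0.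
have [sa | nsa] := boolP (a \in s).
  by exists p => b; rewrite inE => /predU1P[-> | ]; apply: Dp.
pose w := (\prod_(b <- s) ('X - b%:P)) ^+ k.
have /Bezout_eq1_coprimepP[[u t] /= Bez] : coprimep w (('X - a%:P) ^+ k).
  rewrite coprimep_expl // coprimep_expr // coprimep_XsubC root_prod_XsubC.
  by [].
(* u * w is 1 modulo (X - a)^k and 0 modulo the other moduli. *)
exists (p + u * w * (a%:P - p)) => b; rewrite inE => /predU1P[-> | sb].
  apply/dvdpP; exists (t * (p - a%:P)).
  have -> : u * w = 1 - t * ('X - a%:P) ^+ k by rewrite -Bez addrK.
  by move: (_ ^+ k) => E; ring.
rewrite addrAC dvdp_addr ?Dp // -mulrA dvdp_mull // dvdp_mulr //.
by rewrite dvdp_exp2r // (big_rem b sb) dvdp_mulr.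
Qed.

(** The spare condition p(c) = c is what makes functionals with eigenvalue c
    under S + N keep that eigenvalue under S. *)
Lemma semisimple_part_polact (K : fieldType) (V : lmodType K)
    (S N : {linear V -> V}) v (c : K) :
    (forall v, S (N v) = N (S v)) -> jordan_sum S N v ->
  exists2 p : {poly K}, p.[c] = c & polact (S \+ N) p v = S v.
Proof.
move=> SN /(jordan_sum_semisimple_part SN)[s [k Dv]].
(* The exponent k.+1 is positive, so that p - c vanishes at c. *)
have [p Dp] := poly_interpolation (c :: s) k.+1.
exists p; last first.
  apply: Dv => a sa; apply: dvdp_trans (Dp a _); last by rewrite inE sa orbT.
  by rewrite dvdp_exp2l.
have /dvdpP[q Dq] := Dp c (mem_head _ _).
have := congr1 (horner^~ c) Dq.
by rewrite hornerM horner_exp !hornerE subrr expr0n mulr0 => /subr0_eq.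
Qed.

(** * Jordan sums and derivations *)

Section Derivations.
Variables (K : fieldType) (A : comAlgType K).

Definition derivation (d : A -> A) := forall f g, d (f * g) = d f * g + f * d g.

Lemma derivation1 d : derivation d -> d 1 = 0.
Proof.
move=> /(_ 1 1)/eqP; rewrite !mulr1 mul1r -subr_eq0 opprD addNKr oppr_eq0.
by move/eqP.
Qed.

Variables S N : {linear A -> A}.
Hypotheses (derS : derivation S) (derN : derivation N).

(** The Leibniz formula puts at least k factors N on f or l of them on g in each
    term. *)
Lemma iter_derivationM k l m f g : (k + l <= m)%N ->
  iter k N f = 0 -> iter l N g = 0 -> iter m N (f * g) = 0.
Proof.
elim: m k l f g => [|m IHm] k l f g.
  by rewrite leqn0 addn_eq0 => /andP[/eqP-> _] /= -> _; rewrite mul0r.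
case: k => [_ /= -> _|k]; first by rewrite mul0r linear0 linear0.
case: l => [_ _ /= ->|l]; first by rewrite mulr0 linear0 linear0.
move=> le_kl; rewrite !iterSr => Nf Ng.
rewrite derN linearD /=.
rewrite (IHm k l.+1) ?iterSr // (IHm k.+1 l) ?iterSr ?addr0 //.
by rewrite -ltnS -addnS.
Qed.

(** Eigenvalues of S add under products and nilpotency orders of N add too. *)
Lemma jordan_sum_mul f g :
  jordan_sum S N f -> jordan_sum S N g -> jordan_sum S N (f * g).
Proof.
move=> + Jg; elim=> [|a k u {}f Su Nu _ IHf].
  by rewrite mul0r; apply: jordan_sum0.
rewrite mulrDl; apply: jordan_sum_add IHf.
elim: Jg => [|b l w {}g Sw Nw _ IHg].
  by rewrite mulr0; apply: jordan_sum0.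
rewrite mulrDr; apply: jordan_sum_add IHg.
apply: (@jordan_sum_vector _ _ _ _ (a + b) (k + l)); last first.
  exact: iter_derivationM Nu Nw.
by rewrite derS Su Sw -scalerAl -scalerAr scalerDl.
Qed.

Lemma jordan_sum_one : jordan_sum S N 1.
Proof.
apply: (@jordan_sum_vector _ _ _ _ 0 1); last exact: derivation1.
by rewrite scale0r derivation1.
Qed.

End Derivations.

(** * Matrices *)

Section MatrixJordan.
Variables (C : closedFieldType).

(** S is p(X), where p is congruent to a modulo a high power of X - a for each
    root a of the characteristic polynomial.  The latter then divides the
    product of the p - a over the distinct roots, so that S is annihilated by a
    polynomial with simple roots; it also divides a power of X - p. *)
Lemma matrix_jordan_decomposition n (X : 'M[C]_n) : exists S N : 'M[C]_n,
  [/\ X = S + N, diagonalizable S, exists k, N ^+ k = 0 & S *m N = N *m S].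
Proof.
case: n X => [|n] X.
  exists X, 0; split; rewrite ?addr0 ?mulmx0 ?mul0mx //; last by exists 1.
  by rewrite [X]thinmx0; apply: diagonalizable0.
have [rs Drs] := closed_field_poly_normal (char_poly X).
rewrite (monicP (char_poly_monic X)) scale1r in Drs.
pose k := size rs.
(* The size of rs bounds the multiplicity of every root. *)
have [p Dp] := poly_interpolation rs k.
have dvd_prod (r : seq C) (F G : C -> {poly C}) :
    (forall a, a \in r -> F a %| G a) ->
    \prod_(a <- r) F a %| \prod_(a <- r) G a.
  move=> dvdFG; rewrite big_seq [X in _ %| X]big_seq.
  by elim/big_ind2: _ => // *; apply: dvdp_mul.
have ev0 q : \prod_(a <- rs) ('X - a%:P) %| q -> horner_mx X q = 0.
  by rewrite -Drs => /dvdpP[r ->]; rewrite rmorphM /= Cayley_Hamilton mulr0.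
exists (horner_mx X p), (X - horner_mx X p).
split; first by rewrite addrC subrK.
- apply/diagonalizableP; exists (undup rs); first exact: undup_uniq.
  apply/mxminpoly_minP; rewrite rmorph_prod.
  under eq_bigr => a _ do
    rewrite rmorphB /= horner_mx_X horner_mx_C -(horner_mx_C X) -rmorphB.
  rewrite -rmorph_prod; apply: ev0; rewrite -prodr_undup_exp_count.
  apply: dvd_prod => a; rewrite mem_undup => /Dp; apply: dvdp_trans.
  by rewrite dvdp_exp2l ?count_size.
- exists k; have -> : X - horner_mx X p = horner_mx X ('X - p).
    by rewrite rmorphB /= horner_mx_X.
  rewrite -rmorphXn; apply: ev0; rewrite -[_ ^+ k]iter_mulr_1 /k.
  rewrite -count_predT -big_const_seq; apply: dvd_prod => a rsa.
  rewrite -[p](subrK a%:P) opprD addrCA dvdp_addl // dvdpNr.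
  apply: dvdp_trans (Dp a rsa); rewrite -{1}['X - _]expr1 dvdp_exp2l //.
  by rewrite /k; case: (rs) rsa.
have commX : horner_mx X p * X = X * horner_mx X p.
  by rewrite -[X in _ * X = X * _](horner_mx_X X) -!rmorphM mulrC.
by rewrite mulmxBl mulmxBr; congr (_ - _).
Qed.

(** The parameter c interpolates between left multiplication (c = 0), which
    governs the linear forms on matrices, and ad Y (c = 1). *)
Definition twist n c (Y A : 'M[C]_n) : 'M[C]_n := Y *m A - c *: (A *m Y).

Lemma twist_linear n c (Y : 'M[C]_n) : linear (twist c Y).
Proof.
move=> a A B; rewrite /twist mulmxDr mulmxDl -scalemxAr -scalemxAl.
by rewrite scalerDr scalerBr opprD addrACA !scalerA mulrC.
Qed.

HB.instance Definition _ n c Y :=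
  GRing.isLinear.Build C 'M[C]_n 'M[C]_n _ (twist c Y) (twist_linear c Y).

Lemma twist_comm n c (Y Z A : 'M[C]_n) :
  Y *m Z = Z *m Y -> twist c Y (twist c Z A) = twist c Z (twist c Y A).
Proof.
move=> YZ; rewrite /twist !mulmxBl !mulmxBr -!scalemxAl -!scalemxAr !mulmxA.
rewrite YZ -[A *m Y *m Z]mulmxA YZ mulmxA; apply/matrixP => i j.
by rewrite !mxE; ring.
Qed.

(** Left and right multiplication by N commute and are nilpotent of order k, so
    each term of the expanded 2k-th power vanishes. *)
Lemma iter_twist_nilpotent n c (N A : 'M[C]_n) k :
  N ^+ k = 0 -> iter (k + k) (twist c N) A = 0.
Proof.
move=> Nk0.
have Nge i : (k <= i)%N -> N ^+ i = 0.
  by move=> /subnK <-; rewrite exprD Nk0 mulr0.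
(* Each application of twist c N moves one factor N to the left or right end. *)
suff iterN m i j : (k + k <= m + (i + j))%N ->
    iter m (twist c N) (N ^+ i *m A *m N ^+ j) = 0.
  by have := @iterN (k + k) 0 0; rewrite expr0 mulmx1 mul1mx addn0; apply.
elim: m i j => [|m IHm] i j le_k /=.
  have [/Nge->|ltik] := leqP k i; first by rewrite !mul0mx.
  rewrite (Nge j) ?mulmx0 // leqNgt; apply/negP => ltjk.
  by have := leq_ltn_trans le_k (leq_add ltik (ltnW ltjk)); rewrite ltnn.
rewrite -iterS iterSr.
have -> : twist c N (N ^+ i *m A *m N ^+ j) =
    (- c) *: (N ^+ i *m A *m N ^+ j.+1) + N ^+ i.+1 *m A *m N ^+ j.
  rewrite (exprS _ i) (exprSr _ j) -[N ^+ j * N]/(N ^+ j *m N).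
  by rewrite -[N * N ^+ i]/(N *m N ^+ i) /twist !mulmxA addrC scaleNr.
by rewrite linearP /= !IHm ?scaler0 ?addr0 //;
  rewrite ?(addnS, addSn) in le_k *.
Qed.

(** If P diagonalizes S, the conjugates of the matrix units by P are
    eigenvectors of both multiplications by S. *)
Lemma jordan_sum_twist n c (S N A : 'M[C]_n) k :
  diagonalizable S -> N ^+ k = 0 -> jordan_sum (twist c S) (twist c N) A.
Proof.
case=> P Punit /(similar_diagLR Punit)[d DS] Nk0.
rewrite conjVmx // in DS; pose E i j := invmx P *m delta_mx i j *m P.
have -> : A = \sum_i \sum_j (P *m A *m invmx P) i j *: E i j.
  rewrite -[LHS](mulKmx Punit) -[P *m A in LHS](mulmxKV Punit) mulmxA.
  rewrite [P *m A *m _ in LHS]matrix_sum_delta mulmx_sumr mulmx_suml.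
  apply: eq_bigr => i _; rewrite mulmx_sumr mulmx_suml; apply: eq_bigr => j _.
  by rewrite -scalemxAr -scalemxAl.
apply: jordan_sum_bigsum => i; apply: jordan_sum_bigsum => j.
apply: jordan_sum_scale.
apply: (@jordan_sum_vector _ _ _ _ (d 0 i - c * d 0 j) (k + k)); last first.
  exact: iter_twist_nilpotent.
have SE : S *m E i j = d 0 i *: E i j.
  rewrite DS /E !mulmxA mulmxK // -[_ *m diag_mx d *m _]mulmxA mul_diag_mx.
  rewrite scalemxAl scalemxAr; congr (_ *m _ *m _); apply/matrixP => a b.
  by rewrite !mxE; have [->|_] := eqVneq a i; rewrite //= !mulr0.
have ES : E i j *m S = d 0 j *: E i j.
  rewrite DS /E !mulmxA mulmxK // -[_ *m delta_mx i j *m _]mulmxA mul_mx_diag.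
  rewrite scalemxAl scalemxAr; congr (_ *m _ *m _); apply/matrixP => a b.
  by rewrite !mxE mulrC; have [->|_] := eqVneq b j; rewrite ?andbF ?mulr0.
by rewrite /= /twist SE ES scalerA scalerBl.
Qed.

End MatrixJordan.

(** * Left-invariant vector fields on the algebra of polynomials *)

Lemma mpoly_generated (K : fieldType) m (P : {mpoly K[m]} -> Prop) :
    P 0 -> P 1 -> (forall i, P 'X_i) ->
    (forall c p, P p -> P (c *: p)) ->
    (forall p q, P p -> P q -> P (p + q)) ->
    (forall p q, P p -> P q -> P (p * q)) ->
  forall p, P p.
Proof.
move=> P0 P1 PX PZ PD PM; elim/mpolyind=> // c mon p _ _ Pp.
apply: PD => //; apply: PZ; rewrite mpolyXE_id.
elim/big_ind: _ => // i _.
by elim: (mon i) => [|e IHe]; rewrite ?expr0 // exprS; apply: PM.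
Qed.

Section InvariantFields.
Variables (C : closedFieldType) (n : nat).
Implicit Types (Y A : 'M[C]_n) (p q : {mpoly C[n * n]}).

(** The derivation p |-> (g |-> dp_g(g Y)), by [inv_fieldE]: the k-th inner sum
    is the k-th entry of g Y as a linear form in the entries of g. *)
Definition inv_field Y p : {mpoly C[n * n]} :=
  \sum_k p^`M(k) *
    (\sum_l mxvec (vec_mx (delta_mx 0 l) *m Y) 0 k *: 'X_l).

Lemma inv_field_linear Y : linear (inv_field Y).
Proof.
move=> a p q; rewrite /inv_field scaler_sumr -big_split /=.
apply: eq_bigr => k _.
by rewrite mderivD mderivZ mulrDl scalerAl.
Qed.

HB.instance Definition _ Y :=
  GRing.isLinear.Build C {mpoly C[n * n]} {mpoly C[n * n]} _
    (inv_field Y) (inv_field_linear Y).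

Lemma inv_field_derivation Y : derivation (inv_field Y).
Proof.
move=> p q; rewrite /inv_field mulr_suml mulr_sumr -big_split /=.
by apply: eq_bigr => k _; rewrite mderivM mulrDl -!mulrA [X in _ * X + _]mulrC.
Qed.

Lemma inv_fieldDl Y Z p : inv_field (Y + Z) p = inv_field Y p + inv_field Z p.
Proof.
rewrite /inv_field -big_split /=; apply: eq_bigr => k _; rewrite -mulrDr.
congr (_ * _); rewrite -big_split /=; apply: eq_bigr => l _.
by rewrite mulmxDr linearD mxE scalerDl.
Qed.

(** The linear form g |-> tr (A g), in which the fields act by left
    multiplication on A. *)
Definition trace_form A : {mpoly C[n * n]} :=
  \sum_i \sum_j A j i *: 'X_(mxvec_index i j).

Lemma trace_form_linear : linear trace_form.
Proof.
move=> a A B; rewrite /trace_form scaler_sumr -big_split /=.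
apply: eq_bigr => i _.
rewrite scaler_sumr -big_split /=; apply: eq_bigr => j _.
by rewrite !mxE scalerDl scalerA.
Qed.

HB.instance Definition _ :=
  GRing.isLinear.Build C 'M[C]_n {mpoly C[n * n]} _
    trace_form trace_form_linear.

Lemma trace_form_delta i j : trace_form (delta_mx j i) = 'X_(mxvec_index i j).
Proof.
rewrite /trace_form (bigD1 i) //= (bigD1 j) //= mxE !eqxx scale1r.
rewrite !big1 ?addr0 // => [a nai|b nbj].
  by rewrite big1 // => b _; rewrite mxE (negPf nai) andbF scale0r.
by rewrite mxE (negPf nbj) scale0r.
Qed.

Lemma inv_fieldX Y i j :
  inv_field Y 'X_(mxvec_index i j) = \sum_b Y b j *: 'X_(mxvec_index i b).
Proof.
rewrite /inv_field (bigD1 (mxvec_index i j)) //=.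
rewrite [X in _ + X]big1 ?addr0; last first.
  by move=> k kl; rewrite mderivX mnm1E eq_sym (negPf kl) scale0r mul0r.
rewrite mderivX mnm1E eqxx scale1r.
have -> : (U_(mxvec_index i j) - U_(mxvec_index i j))%MM = 0%MM.
  by apply/mnmP => k; rewrite mnmBE subnn mnm0E.
rewrite mpolyX0 mul1r.
have entry a b : (vec_mx (delta_mx 0 (mxvec_index a b)) *m Y) i j =
    (i == a)%:R * Y b j.
  rewrite vec_mx_delta mxE (bigD1 b) //= mxE eqxx andbT big1 ?addr0 // => c ncb.
  by rewrite mxE (negPf ncb) andbF mul0r.
transitivity (\sum_a \sum_b (vec_mx (delta_mx 0 (mxvec_index a b)) *m Y) i j *:
    'X_(mxvec_index a b) : {mpoly C[n * n]}).
  rewrite pair_bigA (reindex _ (curry_mxvec_bij n n)) /=.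
  by apply: eq_bigr => -[a b] _; rewrite mxvecE.
rewrite (bigD1 i) //= [X in _ + X]big1 ?addr0 => [|a nai].
  by apply: eq_bigr => b _; rewrite entry eqxx mul1r.
by rewrite big1 // => b _; rewrite entry eq_sym (negPf nai) mul0r scale0r.
Qed.

Lemma inv_field_trace_form Y A :
  inv_field Y (trace_form A) = trace_form (Y *m A).
Proof.
rewrite /trace_form linear_sum; apply: eq_bigr => i _; rewrite linear_sum /=.
under eq_bigr => j _ do rewrite linearZ /= inv_fieldX scaler_sumr.
rewrite exchange_big /=; apply: eq_bigr => b _; rewrite mxE scaler_suml.
by apply: eq_bigr => j _; rewrite scalerA mulrC.
Qed.

(** Two derivations that commute on generators commute. *)
Lemma inv_field_comm Y Z p :
  Y *m Z = Z *m Y -> inv_field Y (inv_field Z p) = inv_field Z (inv_field Y p).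
Proof.
move=> YZ; have der := inv_field_derivation; elim/mpoly_generated: p.
- by rewrite !linear0.
- by rewrite !derivation1 ?linear0.
- case/mxvec_indexP=> i j.
  by rewrite -trace_form_delta !inv_field_trace_form !mulmxA YZ.
- by move=> c p IHp; rewrite !linearZ /= IHp.
- by move=> p q IHp IHq; rewrite !linearD /= IHp IHq.
move=> p q IHp IHq; rewrite !der !linearD /= !der IHp IHq.
by rewrite -!addrA; congr (_ + _); rewrite addrCA.
Qed.

Lemma jordan_sum_inv_field S N k p :
    diagonalizable S -> N ^+ k = 0 -> jordan_sum (inv_field S) (inv_field N) p.
Proof.
move=> Sdiag Nk0; have der := inv_field_derivation; elim/mpoly_generated: p.
- exact: jordan_sum0.
- exact: jordan_sum_one (der S) (der N).
- case/mxvec_indexP=> i j; rewrite -trace_form_delta.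
  apply: jordan_sum_image (jordan_sum_twist 0 _ Sdiag Nk0) => A;
    by rewrite /= inv_field_trace_form /twist scale0r subr0.
- by move=> c p; apply: jordan_sum_scale.
- by move=> p q; apply: jordan_sum_add.
- by move=> p q; apply: (jordan_sum_mul (der S) (der N)).
Qed.

End InvariantFields.

(** * Lie algebras of algebraic groups *)

Section AlgebraicLieAlgebra.
Variables (C : closedFieldType) (n : nat) (Q : algGroup C n).

(** The vanishing ideal is stable under the field of S + N, hence under every
    polynomial in it, and the field of S agrees on each p with one of these. *)
Lemma Lie_semisimple_part (S N : 'M[C]_n) k :
    diagonalizable S -> N ^+ k = 0 -> S *m N = N *m S ->
  S + N \in Lie_vspace Q -> S \in Lie_vspace Q.
Proof.
move=> Sdiag Nk0 SN /mem_Lie_vspace tX; apply/mem_Lie_vspace => p Ip.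
suff /(_ _ (alg_group1 Q)) : vanishing_ideal Q (inv_field S p).
  by rewrite inv_fieldE mul1mx.
have [r _ /= <-] := semisimple_part_polact 0
  (fun q => inv_field_comm q SN) (jordan_sum_inv_field p Sdiag Nk0).
apply: (polact_stable (W := vanishing_ideal Q)) => //.
- by move=> g _; rewrite /mx_eval meval0.
- move=> a q f Iq If g Qg; have := conj (Iq g Qg) (If g Qg).
  by rewrite /mx_eval mevalD mevalZ => -[-> ->]; rewrite mulr0 addr0.
by move=> q Iq; rewrite /= -inv_fieldDl; apply: inv_field_ideal.
Qed.

HB.instance Definition _ (K : fieldType) (L : lieAlgType K) (z : L) :=
  GRing.isLinear.Build K L L _ (lie_bracket z) (lie_bracket_linearr z).

(** As xi o ad x = xi, the functional xi satisfies xi o q(ad x) = q(1) xi; the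
    polynomial that gives ad s on y takes the value 1 at 1. *)
Lemma ooms_semisimple (xi : dual (Lie Q)) x :
  Defs.nondegenerate (kirillov xi) -> ooms_element xi x -> semisimple x.
Proof.
move=> nd oomsx.
have [S [N [DX Sdiag [k Nk0] SN]]] := matrix_jordan_decomposition (vsval x).
have LS : S \in Lie_vspace Q.
  by apply: Lie_semisimple_part Sdiag Nk0 SN _; rewrite -DX subvsP.
pose s : Lie Q := vsproj (Lie_vspace Q) S.
have Ds : vsval s = S by rewrite vsprojK.
suff Dx : x = s.
  split; rewrite ?addr0 ?{1}Dx ?Ds //; first by exists 1; rewrite expr1 linear0.
  by rewrite linear0.
apply/subr0_eq/nd => y.
suff xi_s : kirillov xi s y = xi y.
  have -> : kirillov xi (x - s) y = kirillov xi x y - kirillov xi s y.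
    rewrite /kirillov addrC -scaleN1r lie_bracket_linearl scaleN1r addrC.
    by rewrite linearB.
  by rewrite xi_s oomsx subrr.
have bracketE (z u : Lie Q) (A : 'M[C]_n) :
    vsval z = A -> vsval (lie_bracket z u) = twist 1 A (vsval u).
  by move=> <-; rewrite [LHS]Lie_bracketE /twist scale1r.
have [p p1 Dp] := semisimple_part_polact 1 (fun A => twist_comm 1 A SN)
  (jordan_sum_twist 1 (vsval y) Sdiag Nk0).
have Dsy : lie_bracket s y = polact (lie_bracket x) p y.
  apply: val_inj; rewrite -[LHS]/(vsval _) -[RHS]/(vsval _).
  rewrite (bracketE _ _ _ Ds) -[LHS]Dp.
  rewrite (polact_equivariant (g := twist 1 S \+ twist 1 N)) // => u.
  transitivity (twist 1 (S + N) (vsval u)); first exact: bracketE DX.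
  by rewrite /= /twist !scale1r mulmxDl mulmxDr opprD addrACA.
rewrite /kirillov Dsy (polact_equivariant (g := idfun)) => [|u].
  by rewrite (@polact_eigenvector _ _ idfun p 1) ?p1 scale1r.
exact: oomsx.
Qed.

End AlgebraicLieAlgebra.

Theorem lemma5p1 (R : realType) (n : nat) (Q : algGroup R[i] n)
    (Q_frobenius : frobenius (Lie Q))
    (xi : dual (Lie Q)) (xi_regular : regular xi)
    (x : Lie Q) (x_ooms : ooms_element xi x) :
  semisimple x.
Proof.
have xi_nd := (frobenius_regularP xi Q_frobenius).1 xi_regular.
exact: ooms_semisimple xi_nd x_ooms.
Qed.
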